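(* Let $G$ be a finite simple graph on $n\ge 2$ vertices with at least one edge. Then there exist a positive integer $m_0$ and a finite set $F$ of positive multiples of $m_0$ such that $M(G)=m_0\mathbb{N}\setminus F$, where $m_0\mathbb{N}=\{m_0,2m_0,3m_0,\dots\}$.
   Context: For a positive integer $m$, $mK_n$ denotes the $m$-fold complete multigraph on $n$ vertices, with exactly $m$ parallel edges between each pair of distinct vertices. For a graph $G$ on $n$ vertices, $mK_n$ ''can be partitioned into copies of $G$'' if there is a finite list of graphs $G_1,\dots,G_l$, each on the same $n$-element vertex set and each isomorphic to $G$, such that every pair of distinct vertices is an edge of exactly $m$ of the $G_i$. Define $M(G)=\{m\in\mathbb{Z}_{>0} : mK_n \text{ can be partitioned into copies of } G\}$. *)

(* Defs.v *)
From mathcomp Require Import all_boot.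
Set Implicit Arguments.
Unset Strict Implicit.
Unset Printing Implicit Defensive.

Record sgraph (V : finType) := SGraph {
  adj :> rel V;
  adj_sym : symmetric adj;
  adj_irr : irreflexive adj
}.

Definition isomorphic (V W : finType) (G : sgraph V) (H : sgraph W) : Prop :=
  exists2 f : V -> W, bijective f & forall x y, adj H (f x) (f y) = adj G x y.

(* The vertex set of mK_n is 'I_n.  The family H is indexed, so the same copy
   may occur several times and is then counted with multiplicity. *)
Definition partitioned_into_copies (m n : nat) (V : finType) (G : sgraph V) :
    Prop :=
  exists (l : nat) (H : 'I_l -> sgraph 'I_n),
    (forall i, isomorphic G (H i)) /\
    (forall x y : 'I_n, x != y -> #|[set i : 'I_l | adj (H i) x y]| = m).

Definition M (V : finType) (G : sgraph V) (m : nat) : Prop :=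
  0 < m /\ partitioned_into_copies m #|V| G.

(* Main.v *)
Require Import Defs.
From mathcomp Require Import all_boot.
From mathcomp Require Import fingroup perm.
From mathcomp Require Import boolp.

Set Implicit Arguments.
Unset Strict Implicit.
Unset Printing Implicit Defensive.

(** The multiplicities [m] for which [mK_n] can be partitioned form a submonoid
    of the natural numbers: decompositions can be put side by side.  It is not
    trivial, since the family of all images of [G] under permutations of the
    vertices covers every pair equally often, by 2-transitivity of the symmetric
    group.  A nontrivial submonoid of the natural numbers consists of multiples
    of the smallest gap [d] between two of its elements [a] and [a + d], and
    contains all large multiples of [d]. *)

Section Submonoid.

Variable S : nat -> Prop.
Hypotheses (S0 : S 0) (SD : forall a b, S a -> S b -> S (a + b)).

Lemma submonoid_muln k a : S a -> S (k * a).
Proof. by move=> Sa; elim: k => // k IHk; rewrite mulSn; apply: SD. Qed.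

Lemma submonoid_eventually_multiples s : 0 < s -> S s ->
  exists d N, [/\ 0 < d, forall m, S m -> d %| m
                & forall m, d %| m -> N <= m -> S m].
Proof.
move=> s_gt0 Ss.
(* Gaps stand in for differences, as [S] is not closed under subtraction. *)
pose gap d := `[< 0 < d /\ exists2 a, S a & S (a + d) >].
have ex_gap : exists d, gap d by exists s; apply/asboolP; split=> //; exists 0.
case: (ex_minnP ex_gap) => d /asboolP[d_gt0 [a Sa Sad]] d_min.
have dvd_S m : S m -> d %| m.
  (* A nonzero remainder [m %% d] would be a gap smaller than [d]: it separates [m %/ d * (a + d)]
     from [m + m %/ d * a], both in [S]. *)
  move=> Sm; rewrite /dvdn -leqn0 leqNgt; apply/negP => r_gt0.
  have := ltn_pmod m d_gt0; rewrite ltnNge => /negP; apply.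
  apply/d_min/asboolP; split=> //.
  exists (m %/ d * (a + d)); first exact: submonoid_muln.
  have -> : m %/ d * (a + d) + m %% d = m + m %/ d * a.
    by rewrite mulnDr -addnA -divn_eq addnC.
  by apply: SD => //; apply: submonoid_muln.
have /dvdnP[k a_eq] := dvd_S _ Sa.
(* With [a = k * d] and [m = t * d], the bound gives [k <= t %/ k], which exceeds [t %% k]. So
   [t * d] is a sum of [t %/ k] terms, of which [t %% k] equal [a + d] and the others [a]. *)
exists d, (k * k * d); split=> // m /dvdnP[t ->]; rewrite leq_pmul2r // => le_t.
(* If [k = 0] then [a = 0], and [d] itself lies in [S]. *)
have [k0|k_gt0] := posnP k.
  by apply: submonoid_muln; rewrite a_eq k0 in Sad.
have le_rq : t %% k <= t %/ k.
  by apply/ltnW/(leq_trans (ltn_pmod t k_gt0)); rewrite leq_divRL.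
have -> : t * d = (t %/ k - t %% k) * a + t %% k * (a + d).
  by rewrite mulnDr addnA -mulnDl subnK // a_eq mulnA -mulnDl -divn_eq.
by apply: SD; apply: submonoid_muln.
Qed.

End Submonoid.

(** Frees later constructions from ordinal indices: the empty type, a sum type and the permutations
    will index copies. *)
Lemma partitioned_by_family (I : finType) m n (V : finType) (G : sgraph V)
    (H : I -> sgraph 'I_n) :
  (forall i, isomorphic G (H i)) ->
  (forall x y : 'I_n, x != y -> #|[set i | adj (H i) x y]| = m) ->
  partitioned_into_copies m n G.
Proof.
move=> isoH cardH; exists #|I|, (H \o enum_val); split=> [i|x y /cardH <-].
  exact: isoH.
rewrite -(card_imset _ enum_val_inj); apply: eq_card => i.
rewrite inE; apply/imsetP/idP => [[j + ->]|Hi]; first by rewrite inE.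
by exists (enum_rank i); rewrite ?inE /= enum_rankK.
Qed.

Lemma partitioned0 n (V : finType) (G : sgraph V) :
  partitioned_into_copies 0 n G.
Proof.
apply: (@partitioned_by_family void _ _ _ _ (of_void _)) => [[]|x y _].
by apply: eq_card0 => -[].
Qed.

Lemma partitionedD m1 m2 n (V : finType) (G : sgraph V) :
  partitioned_into_copies m1 n G -> partitioned_into_copies m2 n G ->
  partitioned_into_copies (m1 + m2) n G.
Proof.
move=> [l1 [H1 [iso1 card1]]] [l2 [H2 [iso2 card2]]].
pose H (i : 'I_l1 + 'I_l2) := match i with inl j => H1 j | inr j => H2 j end.
apply: (@partitioned_by_family _ _ _ _ _ H) => [[]//|x y xy].
rewrite -(card1 x y xy) -(card2 x y xy) -!sum1dep_card big_sumType /=.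
by rewrite !sum1dep_card.
Qed.

Lemma perm_2transitive (T : finType) (x y x' y' : T) : x != y -> x' != y' ->
  exists t : {perm T}, t x = x' /\ t y = y'.
Proof.
move=> xy xy'; pose t := tperm x x'.
have tx : t x = x' by rewrite tpermL.
(* The second transposition corrects the image of [y] and fixes [x'], which differs from both [t y]
   and [y']. *)
exists (t * tperm (t y) y')%g; rewrite !permM tx tpermL; split=> //.
by rewrite tpermD // 1?eq_sym // -tx (inj_eq perm_inj).
Qed.

Section PermutedCopies.

Variables (V : finType) (G : sgraph V).
Implicit Types s : {perm 'I_#|V|}.

Definition permuted_adj s : rel 'I_#|V| :=
  fun x y => adj G (enum_val (s x)) (enum_val (s y)).

Lemma permuted_adj_sym s : symmetric (permuted_adj s).
Proof. by move=> x y; apply: adj_sym. Qed.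

Lemma permuted_adj_irr s : irreflexive (permuted_adj s).
Proof. by move=> x; apply: adj_irr. Qed.

Definition permuted_copy s : sgraph 'I_#|V| :=
  SGraph (permuted_adj_sym s) (permuted_adj_irr s).

Lemma permuted_copy_iso s : isomorphic G (permuted_copy s).
Proof.
exists (fun x => (s^-1)%g (enum_rank x)) => [|x y].
  by exists (fun x => enum_val (s x)) => x;
    rewrite ?permKV ?enum_rankK ?enum_valK ?permK.
by rewrite /= /permuted_adj !permKV !enum_rankK.
Qed.

(** If [t] sends [x, y] to [x', y'], then [u] maps to [t * u] bijectively from the permutations
    counted on the right to those counted on the left. *)
Lemma card_permuted_copies (x y x' y' : 'I_#|V|) : x != y -> x' != y' ->
  #|[set s | permuted_copy s x y]| = #|[set s | permuted_copy s x' y']|.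
Proof.
move=> xy xy'; have [t [tx ty]] := perm_2transitive xy xy'.
rewrite -[RHS](card_imset _ (mulgI t)); apply: eq_card => s.
rewrite inE; apply/idP/imsetP => [Gs|[u + ->]]; last first.
  by rewrite inE /= /permuted_adj !permM tx ty.
exists (t^-1 * s)%g; last by rewrite mulKVg.
by rewrite inE /= /permuted_adj !permM -tx -ty !permK.
Qed.

Lemma partitioned_gt0 (x y : V) : adj G x y ->
  exists2 m, 0 < m & partitioned_into_copies m #|V| G.
Proof.
move=> Gxy; set x0 := enum_rank x; set y0 := enum_rank y.
have xy0 : x0 != y0.
  by rewrite (inj_eq enum_rank_inj); apply: contraTneq Gxy => ->;
    rewrite adj_irr.
exists #|[set s | permuted_copy s x0 y0]|.
  (* The identity copy contains the given edge. *)
  apply/card_gt0P; exists 1%g.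
  by rewrite inE /= /permuted_adj !perm1 !enum_rankK.
apply: (partitioned_by_family permuted_copy_iso) => x' y' xy'.
exact: card_permuted_copies.
Qed.

End PermutedCopies.

Theorem theorem1 (V : finType) (G : sgraph V)
  (hn : 2 <= #|V|) (hG : exists x y : V, adj G x y) :
  exists (m0 : nat) (F : seq nat),
    [/\ 0 < m0,
        forall k : nat, k \in F -> 0 < k /\ m0 %| k &
        forall m : nat, M G m <-> [/\ 0 < m, m0 %| m & m \notin F]].
Proof.
have [x [y /partitioned_gt0[s s_gt0 Ss]]] := hG.
have [d [N [d_gt0 dvd_S large_S]]] := submonoid_eventually_multiples
  (partitioned0 _ G) (fun a b => @partitionedD a b _ _ G) s_gt0 Ss.
(* All exceptions lie below [N], so filtering an initial segment finds them. *)
pose gaps := [seq k <- iota 0 N |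
  [&& 0 < k, d %| k & ~~ `[< partitioned_into_copies k #|V| G >]]].
exists d, gaps; split=> // [k|m].
  by rewrite mem_filter => /andP[/and3P[]].
rewrite mem_filter mem_iota /=; split=> [[m_gt0 Sm]|[m_gt0 dm]].
  by rewrite m_gt0 dvd_S //= (asboolT Sm).
rewrite m_gt0 dm /= negb_and negbK -leqNgt => /orP[/asboolP Sm|/(large_S m dm)].
  by split.
by split.
Qed.
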